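(* Let $n\geq 2$ be an integer and let $K_{n,n}$ be the complete bipartite graph with vertex set $\{a_1,\dots,a_n\}\sqcup\{b_1,\dots,b_n\}$ and edge set $\{\{a_i,b_j\}: i,j\in[n]\}$. Then the $(n-1)$-matching complex $M_{n-1}(K_{n,n})$ is homotopy equivalent to the sphere $\mathbb{S}^{(n-1)^2-1}$.
   Context: For an integer $r\geq 1$ and a finite simple graph $G$, a subset $H\subseteq E(G)$ of edges is an $r$-matching if every vertex of $G$ has degree at most $r$ in the subgraph with vertex set $V(G)$ and edge set $H$. The $r$-matching complex $M_r(G)$ is the abstract simplicial complex whose vertex set is $E(G)$ and whose faces are all $r$-matchings of $G$ (including the empty set); it is regarded as a topological space via its geometric realization. *)

(* Defs.v *)
From HB Require Import structures.
From mathcomp Require Import all_boot all_order all_algebra.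
From mathcomp Require Import all_classical all_reals topology normedtype.

Set Implicit Arguments.
Unset Strict Implicit.
Unset Printing Implicit Defensive.

Import Order.TTheory GRing.Theory Num.Theory.
Import numFieldNormedType.Exports.

Local Open Scope classical_set_scope.
Local Open Scope ring_scope.

Record sgraph := SGraph {
  vertex :> finType;
  adj : rel vertex;
  adj_sym : symmetric adj;
  adj_irrefl : irreflexive adj }.

Definition edges (G : sgraph) : {set {set G}} :=
  [set [set p.1; p.2]%SET | p : G * G & adj p.1 p.2]%SET.

Definition complete_bipartite_adj (m n : nat) : rel ('I_m + 'I_n)%type :=
  fun x y => match x, y with
             | inl _, inr _ | inr _, inl _ => true
             | _, _ => false
             end.

Lemma complete_bipartite_sym (m n : nat) :
  symmetric (@complete_bipartite_adj m n).
Proof. by move=> [i|i] [j|j]. Qed.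

Lemma complete_bipartite_irrefl (m n : nat) :
  irreflexive (@complete_bipartite_adj m n).
Proof. by move=> [i|i]. Qed.

Definition complete_bipartite (m n : nat) : sgraph :=
  SGraph (@complete_bipartite_sym m n) (@complete_bipartite_irrefl m n).

Lemma edges_complete_bipartite (m n : nat) :
  edges (complete_bipartite m n) =
  [set [set inl ij.1; inr ij.2]%SET | ij : 'I_m * 'I_n]%SET.
Proof.
apply/setP => e; apply/imsetP/imsetP.
  move=> [[[i|i] [j|j]]]; rewrite inE //= => _ ->.
    by exists (i, j).
  by exists (j, i) => //=; rewrite finset.setUC.
by move=> [[i j] _ ->]; exists (inl i, inr j); rewrite ?inE.
Qed.

(* Abstract simplicial complexes with vertices taken from a finite type T;
   an element v of T is a vertex of the complex when [set v] is a face. *)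
Record scomplex (T : finType) := SComplex {
  faces : {set {set T}};
  faces0 : finset.set0 \in faces;
  faces_sub : forall A B : {set T},
    A \subset B -> B \in faces -> A \in faces }.

Definition vertices (T : finType) (K : scomplex T) : {set T} :=
  [set v | [set v]%SET \in faces K]%SET.

Definition degree_in (G : sgraph) (H : {set {set G}}) (v : G) : nat :=
  #|[set e in H | v \in e]%SET|.

Definition is_matching (r : nat) (G : sgraph) (H : {set {set G}}) : bool :=
  (H \subset edges G) && [forall v : G, (degree_in H v <= r)%N].

Lemma is_matching0 (r : nat) (G : sgraph) :
  finset.set0 \in [set H | is_matching r (G := G) H]%SET.
Proof.
rewrite inE /is_matching finset.sub0set; apply/forallP => v.
rewrite /degree_in (_ : [set e in _ | _]%SET = finset.set0) ?cards0 //.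
by apply/setP => e; rewrite !inE.
Qed.

Lemma is_matching_sub (r : nat) (G : sgraph) (A B : {set {set G}}) :
  A \subset B -> B \in [set H | is_matching r H]%SET ->
  A \in [set H | is_matching r H]%SET.
Proof.
move=> sAB; rewrite !inE => /andP[sBE /forallP dB]; apply/andP; split.
  exact: (fintype.subset_trans sAB).
apply/forallP => v; apply: leq_trans (dB v); apply: subset_leq_card.
by apply/fintype.subsetP => e; rewrite !inE => /andP[/(fintype.subsetP sAB) -> ->].
Qed.

Definition matching_complex (r : nat) (G : sgraph) : scomplex {set G} :=
  SComplex (is_matching0 r G) (@is_matching_sub r G).

Lemma vertices_matching_complex (r : nat) (G : sgraph) :
  (0 < r)%N -> vertices (matching_complex r G) = edges G.
Proof.
move=> r0; apply/setP => e; rewrite !inE /is_matching finset.sub1set.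
rewrite andb_idr// => _; apply/forallP => v; apply: leq_trans r0.
rewrite -(cards1 e); apply: subset_leq_card.
by apply/fintype.subsetP => f; rewrite !inE => /andP[].
Qed.

(* Barycentric coordinates. As T is finite, the topology of pointwise
   convergence restricts to the usual topology of the realization. *)
Definition realization (R : realType) (T : finType) (K : scomplex T) :
    set {ptws T -> R} :=
  [set x : {ptws T -> R} |
    [/\ forall v, 0 <= x v,
      \sum_v x v = 1 &
      [set v | x v != 0]%SET \in faces K]].

Arguments realization R {T} K _.

(* The unit sphere of dimension d for the Euclidean norm (the norm of the
   library on row vectors is the sup norm). *)
Definition sphere (R : realType) (d : nat) : set 'rV[R]_d.+1 :=
  [set x : 'rV[R]_d.+1 | \sum_i x ord0 i ^+ 2 = 1].

Arguments sphere R d _ : clear implicits.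

Definition homotopic (R : realType) (X Y : topologicalType) (f g : X -> Y) :=
  exists H : X * R -> Y,
    [/\ {within [set: X] `*` `[0, 1], continuous H},
        forall x, H (x, 0) = f x &
        forall x, H (x, 1) = g x].

Definition homotopy_equivalent (R : realType) (X Y : topologicalType) :=
  exists (f : X -> Y) (g : Y -> X),
    [/\ continuous f, continuous g,
        homotopic R (g \o f) idfun &
        homotopic R (f \o g) idfun].

(* Main.v *)
(* A point of the complex is a nonnegative matrix of total sum 1 having a zero
   in every row and in every column. Let W be the space of matrices a_i + b_j;
   the mixed differences A_ij - A_i0 - A_0j + A_00 identify R^(n x n) / W with
   R^((n-1)^2). Subtracting from a matrix its row minima, then the resulting
   column minima (the first step of the Hungarian algorithm), is a continuous
   map that preserves classes mod W, lands in the nonnegative matrices with a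
   zero in every row and column, and fixes those. Such a matrix lies in W only
   if it is 0, so after rescaling, "take the class mod W" and "reduce" are maps
   between the complex and the sphere. The composite on the sphere is the
   identity; on the complex, reduce the segment from x to a representative of
   its (rescaled) class: it never meets W. *)

Require Import Defs.
From mathcomp Require Import all_boot all_order all_algebra.
From mathcomp Require Import all_classical all_reals topology normedtype.
From mathcomp Require Import realfun ring lra.
Import numFieldNormedType.Exports.
Import Order.TTheory GRing.Theory Num.Theory.

Set Implicit Arguments.
Unset Strict Implicit.
Unset Printing Implicit Defensive.

Local Open Scope classical_set_scope.
Local Open Scope ring_scope.

(** * Minimum of a real function on a nonempty finite type *)

Section FiniteMinimum.
Variables (R : realType) (I : finType) (i0 : I).

(** The seed [f i0] is itself a value of [f], so it cannot undercut the true minimum as a numeric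
    default could. *)
Definition fmin (f : I -> R) : R := \big[Num.min/f i0]_i f i.

Lemma fmin_le f i : fmin f <= f i.
Proof. exact: bigmin_le. Qed.

Lemma fmin_attained f : exists i, fmin f = f i.
Proof.
rewrite /fmin; elim/big_ind: _ => [|x y [i ->] [j ->]|i _]; first by exists i0.
  by rewrite minEle; case: ifP => _; [exists i | exists j].
by exists i.
Qed.

Lemma fmin_eq0 f i : (forall j, 0 <= f j) -> f i = 0 -> fmin f = 0.
Proof.
move=> f0 fi; apply/eqP; rewrite eq_le -{1}fi fmin_le /=.
by have [j ->] := fmin_attained f.
Qed.

End FiniteMinimum.

(** * Hungarian reduction and mixed differences of matrices *)

Section Reduction.
Variables (R : realType) (I J : finType) (i0 : I) (j0 : J).
Implicit Types A B : I -> J -> R.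

Definition reduced A :=
  [/\ forall i j, 0 <= A i j, forall i, exists j, A i j = 0 &
      forall j, exists i, A i j = 0].

Definition reduce_rows A i j := A i j - fmin j0 (A i).

Definition reduce A i j := reduce_rows A i j - fmin i0 (reduce_rows A ^~ j).

Definition mixed A i j := A i j - A i j0 - A i0 j + A i0 j0.

Definition entry_sum A := \sum_i \sum_j A i j.

(** Subtracting column minima keeps the zeros made in the rows: after the first step all entries are
    nonnegative, so a column containing a zero has minimum 0 and is left unchanged. *)
Lemma reduce_reduced A : reduced (reduce A).
Proof.
have rows_ge0 i j : 0 <= reduce_rows A i j by rewrite subr_ge0 fmin_le.
split=> [i j|i|j]; first by rewrite subr_ge0 (fmin_le _ (reduce_rows A ^~ j)).
- have [j fminE] := fmin_attained j0 (A i); exists j.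
  have rows0 : reduce_rows A i j = 0 by rewrite /reduce_rows fminE subrr.
  by rewrite /reduce (@fmin_eq0 _ _ _ (reduce_rows A ^~ j) i) // rows0 subrr.
- have [i fminE] := fmin_attained i0 (reduce_rows A ^~ j); exists i.
  by rewrite /reduce fminE subrr.
Qed.

Lemma reduce_id A i j : reduced A -> reduce A i j = A i j.
Proof.
case=> A0 rows cols.
have rowsE k l : reduce_rows A k l = A k l.
  have [l' Akl'] := rows k.
  by rewrite /reduce_rows (@fmin_eq0 _ _ _ (A k) l') ?subr0.
rewrite /reduce rowsE; have [k Akj] := cols j.
by rewrite (@fmin_eq0 _ _ _ _ k) ?subr0 // => [l|]; rewrite rowsE.
Qed.

(** Reduction subtracts a function of [i], then a function of [j]; both cancel in mixed
    differences. *)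
Lemma mixed_reduce A i j : mixed (reduce A) i j = mixed A i j.
Proof. by rewrite /mixed /reduce /reduce_rows; ring. Qed.

Lemma mixedZ a A i j : mixed (fun k l => A k l / a) i j = mixed A i j / a.
Proof. by rewrite /mixed; ring. Qed.

Lemma mixed_lin a b A B i j :
  mixed (fun k l => a * A k l + b * B k l) i j = a * mixed A i j + b * mixed B i j.
Proof. by rewrite /mixed; ring. Qed.

(* A matrix with vanishing mixed differences has the form [a i + b j]; if it
   is reduced, its row and column minima force [a] and [b] to be opposite
   constants. *)
Lemma reduced_eq0 A :
  reduced A -> (forall i j, mixed A i j = 0) -> forall i j, A i j = 0.
Proof.
case=> A0 rows cols mixed0.
have AE i j : A i j = A i j0 + A i0 j - A i0 j0.
  by have := mixed0 i j; rewrite /mixed; lra.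
have [j1 Ai0j1] := rows i0; have [i1 Ai1j0] := cols j0.
have A00 : A i0 j0 = 0.
  by have := AE i1 j1; have := A0 i1 j1; have := A0 i0 j0; lra.
have Aj0 i : A i j0 = 0.
  have [j Aij] := rows i.
  by have := AE i j; have := A0 i j0; have := A0 i0 j; lra.
have Ai0 j : A i0 j = 0.
  have [i Aij] := cols j.
  by have := AE i j; have := A0 i j0; have := A0 i0 j; lra.
by move=> i j; rewrite AE Aj0 Ai0 A00; lra.
Qed.

(** A nonnegative matrix of sum 0 vanishes, and so do its mixed differences. This makes the division
    in [normalize] legitimate. *)
Lemma entry_sum_gt0 A : reduced A -> (exists i j, mixed A i j != 0) -> 0 < entry_sum A.
Proof.
move=> redA [i [j mixedN0]]; have [A0 _ _] := redA.
rewrite lt_def sumr_ge0 ?andbT => [|k _]; last exact: sumr_ge0.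
apply: contra_neq mixedN0 => /eqP.
rewrite psumr_eq0 => [/allP rows0|k _]; last exact: sumr_ge0.
have AE k l : A k l = 0.
  have := rows0 k; rewrite mem_index_enum /= => /(_ isT).
  by rewrite psumr_eq0 // => /allP /(_ l); rewrite mem_index_enum => /(_ isT) /eqP.
by rewrite /mixed !AE; lra.
Qed.

Definition normalize A i j := A i j / entry_sum A.

Lemma entry_sum_normalize A : entry_sum A != 0 -> entry_sum (normalize A) = 1.
Proof.
move=> tN0; rewrite /entry_sum /normalize.
under eq_bigr do rewrite -mulr_suml.
by rewrite -mulr_suml divff.
Qed.

Lemma normalize_reduced A : 0 < entry_sum A -> reduced A -> reduced (normalize A).
Proof.
move=> t0 [A0 rows cols]; split=> [i j|i|j].
- by rewrite divr_ge0 // ltW.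
- by have [j Aij] := rows i; exists j; rewrite /normalize Aij mul0r.
- by have [i Aij] := cols j; exists i; rewrite /normalize Aij mul0r.
Qed.

End Reduction.

(** * Vertex degrees in complete bipartite graphs *)

Section Matchings.
Variables (m n : nat).
Local Notation G := (complete_bipartite m n).

Definition bip_edge (p : 'I_m * 'I_n) : {set G} := [set inl p.1; inr p.2]%SET.

Lemma in_bip_edgel p i : (inl i \in bip_edge p) = (i == p.1).
Proof. by rewrite !inE orbF. Qed.

Lemma in_bip_edger p j : (inr j \in bip_edge p) = (j == p.2).
Proof. by rewrite !inE. Qed.

Lemma bip_edge_inj : injective bip_edge.
Proof.
move=> [i j] [k l] /setP eq_e; congr (_, _).
  by have := eq_e (inl i); rewrite !in_bip_edgel eqxx => /esym/eqP.
by have := eq_e (inr j); rewrite !in_bip_edger eqxx => /esym/eqP.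
Qed.

(** Edges at a left vertex are determined by their right endpoints, so its degree is the size of a
    subset of an ordinal type, as [card_ord_le_pred] expects. *)
Lemma degree_inl (H : {set {set G}}) i : H \subset edges G ->
  degree_in H (inl i) = #|[set j | bip_edge (i, j) \in H]%SET|.
Proof.
rewrite edges_complete_bipartite => /fintype.subsetP sHE.
rewrite -(card_imset _ (f := fun j => bip_edge (i, j))); last first.
  by move=> j k /bip_edge_inj[].
congr #|pred_of_set _|; apply/setP => e; rewrite !inE.
apply/andP/imsetP => [[He]|[j]]; last first.
  by rewrite inE => ? ->; rewrite in_bip_edgel.
have /imsetP[[k j] _ eE] := sHE _ He; have -> : e = bip_edge (k, j) by [].
rewrite in_bip_edgel => /eqP /= ik; exists j; rewrite ?ik //.
by rewrite inE -(_ : e = bip_edge (k, j)).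
Qed.

Lemma degree_inr (H : {set {set G}}) j : H \subset edges G ->
  degree_in H (inr j) = #|[set i | bip_edge (i, j) \in H]%SET|.
Proof.
rewrite edges_complete_bipartite => /fintype.subsetP sHE.
rewrite -(card_imset _ (f := fun i => bip_edge (i, j))); last first.
  by move=> i k /bip_edge_inj[].
congr #|pred_of_set _|; apply/setP => e; rewrite !inE.
apply/andP/imsetP => [[He]|[i]]; last first.
  by rewrite inE => ? ->; rewrite in_bip_edger.
have /imsetP[[i k] _ eE] := sHE _ He; have -> : e = bip_edge (i, k) by [].
rewrite in_bip_edger => /eqP /= jk; exists i; rewrite ?jk //.
by rewrite inE -(_ : e = bip_edge (i, k)).
Qed.

End Matchings.

(** Only the full set has [m.+1] elements. This is where the degree bound n - 1 is special: it just
    says that some edge at the vertex is missing. *)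
Lemma card_ord_le_pred (m : nat) (D : {set 'I_m.+1}) :
  (#|D| <= m)%N = [exists i, i \notin D].
Proof.
rewrite -ltnS -[X in (_ < X)%N](card_ord m.+1) ltn_neqAle max_card andbT.
rewrite -cardsT; apply/idP/existsP => [neq|[i iD]].
  have /subsetPn[i _ iD] : ~~ ([set: 'I_m.+1]%SET \subset D).
    apply: contraNN neq => sTD; rewrite eqn_leq.
    by rewrite !subset_leq_card ?finset.subsetT.
  by exists i.
apply: contraNN iD => /eqP eqD.
suff -> : D = finset.setT by rewrite inE.
by apply/eqP; rewrite eqEcard finset.subsetT eqD leqnn.
Qed.

(** * Points of the complex as reduced matrices of sum 1 *)

Section Realization.
Variables (R : realType) (m : nat).
Local Notation n := m.+2.
Local Notation G := (complete_bipartite n n).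
Local Notation K := (matching_complex m.+1 G).

Definition coords (x : {set G} -> R) (i j : 'I_n) : R := x (bip_edge (i, j)).

(** By injectivity of [bip_edge] the sum has one term when [e] is an edge; otherwise it is empty,
    which gives the extension by 0. *)
Definition of_coords (A : 'I_n -> 'I_n -> R) : {ptws {set G} -> R} :=
  fun e => \sum_(p | bip_edge p == e) A p.1 p.2.

Lemma of_coordsE A i j : of_coords A (bip_edge (i, j)) = A i j.
Proof.
rewrite /of_coords (big_pred1 (i, j)) // => p.
by rewrite (inj_eq (@bip_edge_inj _ _)).
Qed.

Lemma of_coords_out A e : e \notin edges G -> of_coords A e = 0.
Proof.
rewrite edges_complete_bipartite => eN; rewrite /of_coords big_pred0 // => p.
by apply: contraNF eN => /eqP <-; apply/imsetP; exists p.
Qed.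

Lemma sum_of_coords A : \sum_e of_coords A e = entry_sum A.
Proof.
rewrite /entry_sum pair_big /= (partition_big (@bip_edge n n) xpredT) //=.
Qed.

Lemma entry_sum_coords (x : {set G} -> R) :
  (forall e, e \notin edges G -> x e = 0) -> entry_sum (coords x) = \sum_e x e.
Proof.
move=> x0; rewrite -sum_of_coords; apply: eq_bigr => e _.
have [|eN] := boolP (e \in edges G); last by rewrite of_coords_out // x0.
by rewrite edges_complete_bipartite => /imsetP[[i j] _ ->]; rewrite of_coordsE.
Qed.

(** The support omits an edge at a left (right) vertex exactly when the corresponding row (column)
    has a zero entry. *)
Lemma matchingP (x : {set G} -> R) :
  (forall e, e \notin edges G -> x e = 0) ->
  [set e | x e != 0]%SET \in faces K <->
  (forall i, exists j, coords x i j = 0) /\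
  (forall j, exists i, coords x i j = 0).
Proof.
move=> x0; set H := [set e | _]%SET.
have sHE : H \subset edges G.
  by apply/fintype.subsetP => e; rewrite inE; apply: contraNT => /x0 ->.
rewrite inE /is_matching sHE /=; split=> [/forallP deg|[rows cols]].
  split=> [i|j]; [have := deg (inl i) | have := deg (inr j)].
    rewrite degree_inl // card_ord_le_pred => /existsP[j].
    by rewrite !inE negbK => /eqP; exists j.
  rewrite degree_inr // card_ord_le_pred => /existsP[i].
  by rewrite !inE negbK => /eqP; exists i.
apply/forallP => -[i|j]; rewrite ?degree_inl ?degree_inr //.
  rewrite card_ord_le_pred; have [j xij] := rows i.
  by apply/existsP; exists j; rewrite !inE negbK; apply/eqP.
rewrite card_ord_le_pred; have [i xij] := cols j.
by apply/existsP; exists i; rewrite !inE negbK; apply/eqP.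
Qed.

Lemma realization_out (x : {set G} -> R) e :
  realization R K x -> e \notin edges G -> x e = 0.
Proof.
case=> _ _; rewrite inE => /andP[/fintype.subsetP sHE _].
by apply: contraNeq => xe; apply: sHE; rewrite inE.
Qed.

Lemma realizationP (x : {set G} -> R) : realization R K x ->
  reduced (coords x) /\ entry_sum (coords x) = 1.
Proof.
move=> xK; have x0 e := @realization_out x e xK.
case: xK => x_ge0 x1 /(matchingP x0)[rows cols].
split; last by rewrite entry_sum_coords.
by split=> // i j; exact: x_ge0.
Qed.

Lemma coordsK (x : {set G} -> R) : realization R K x -> of_coords (coords x) = x.
Proof.
move=> xK; apply: funext => e.
have [|eN] := boolP (e \in edges G); last first.
  by rewrite of_coords_out // (realization_out xK).
by rewrite edges_complete_bipartite => /imsetP[[i j] _ ->]; rewrite of_coordsE.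
Qed.

Lemma realization_of_coords A :
  reduced A -> entry_sum A = 1 -> realization R K (of_coords A).
Proof.
case=> A0 rows cols A1; split=> [e||].
- by rewrite sumr_ge0 // => p _; exact: A0.
- by rewrite sum_of_coords.
- apply/matchingP => [e /of_coords_out //|]; split=> [i|j].
    by have [j Aij] := rows i; exists j; rewrite /coords of_coordsE.
  by have [i Aij] := cols j; exists i; rewrite /coords of_coordsE.
Qed.

End Realization.

(** * Continuity of reduction, mixed differences and normalization *)

Section Continuity.
Variables (R : realType) (X : topologicalType).

Lemma continuous_to_set_type (Y : topologicalType) (B : set Y)
    (f : X -> set_type B) :
  continuous (fun x => set_val (f x)) -> continuous f.
Proof. exact: continuous_comp_initial. Qed.

Lemma continuous_to_ptws (T : Type) (f : X -> {ptws T -> R}) :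
  (forall t, continuous (fun x => f x t)) -> continuous f.
Proof.
move=> cf x; apply/cvg_sup => t; move: x.
exact: (@continuous_comp_initial _ _ _ (@^~ t) f (cf t)).
Qed.

Lemma continuous_to_mx (k l : nat) (f : X -> 'M[R]_(k, l)) :
  (forall i j, continuous (fun x => f x i j)) -> continuous f.
Proof.
(* A neighbourhood of a matrix contains a box of entrywise neighbourhoods, and finitely many
   conditions can be met at once. *)
move=> cf x A [P PE sPA]; apply: (filterS sPA).
apply: filter_forall => i; apply: filter_forall => j.
exact: cf.
Qed.

Lemma continuous_sumr (I : finType) (P : pred I) (F : I -> X -> R) :
  (forall i, continuous (F i)) -> continuous (fun x => \sum_(i | P i) F i x).
Proof. by move=> cF; apply: continuous_big => //; exact: add_continuous. Qed.

Lemma continuous_fmin (I : finType) (i0 : I) (F : X -> I -> R) :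
  (forall i, continuous (F ^~ i)) -> continuous (fun x => fmin i0 (F x)).
Proof.
move=> cF x; rewrite /fmin.
elim: (index_enum I) => [|i s IHs].
  by under eq_fun do rewrite big_nil; exact: cF.
under eq_fun do rewrite big_cons.
apply: (@continuous_min R X (F ^~ i)
  (fun y => \big[Num.min/F y i0]_(j <- s) F y j)) => //.
exact: cF.
Qed.

Variables (I J : finType) (i0 : I) (j0 : J) (A : X -> I -> J -> R).
Hypothesis cA : forall i j, continuous (fun x => A x i j).

Lemma continuous_reduce i j : continuous (fun x => reduce i0 j0 (A x) i j).
Proof.
have crows k l : continuous (fun x => reduce_rows j0 (A x) k l).
  by move=> x; apply: cvgB; [exact: cA | apply: continuous_fmin => ?; exact: cA].
move=> x; apply: cvgB; first exact: crows.
by apply: (@continuous_fmin _ _ (fun y k => reduce_rows j0 (A y) k j)).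
Qed.

Lemma continuous_mixed i j : continuous (fun x => mixed i0 j0 (A x) i j).
Proof.
by move=> x; apply: cvgD; [apply: cvgB; [apply: cvgB|]|]; exact: cA.
Qed.

Lemma continuous_normalize i j : (forall x, entry_sum (A x) != 0) ->
  continuous (fun x => normalize (A x) i j).
Proof.
move=> sN0 x; apply: cvgM; first exact: cA.
apply: cvgV; first exact: sN0.
by apply: continuous_sumr => k; apply: continuous_sumr => l; exact: cA.
Qed.

End Continuity.

(** * The equivalence between the complex and the sphere *)

Section Equivalence.
Variables (R : realType) (m d : nat).
(** Keeping [d] abstract gives row vectors of length [d.+1] with no casts along this equation. *)
Hypothesis dim_eq : d.+1 = (m.+1 ^ 2)%N.
Local Notation n := m.+2.
Local Notation G := (complete_bipartite n n).
Local Notation K := (matching_complex m.+1 G).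
Implicit Types A : 'I_n -> 'I_n -> R.

Definition nondegenerate A := exists i j, mixed ord0 ord0 A i j != 0.

Definition to_complex A : {ptws {set G} -> R} :=
  of_coords (normalize (reduce ord0 ord0 A)).

Lemma entry_sum_reduce_gt0 A : nondegenerate A -> 0 < entry_sum (reduce ord0 ord0 A).
Proof.
case=> i [j mN0]; apply: (@entry_sum_gt0 _ _ _ ord0 ord0).
  exact: reduce_reduced.
by exists i, j; rewrite mixed_reduce.
Qed.

Lemma to_complex_in A : nondegenerate A -> realization R K (to_complex A).
Proof.
move=> /entry_sum_reduce_gt0 s0; apply: realization_of_coords.
  by apply: normalize_reduced => //; exact: reduce_reduced.
by rewrite entry_sum_normalize // gt_eqF.
Qed.

Lemma to_complex_id (x : {ptws {set G} -> R}) :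
  realization R K x -> to_complex (coords x) = x.
Proof.
move=> xK; have [xred x1] := realizationP xK.
rewrite -[RHS](coordsK xK); congr of_coords.
have rE : reduce ord0 ord0 (coords x) = coords x.
  by apply/funext => i; apply/funext => j; rewrite reduce_id.
by apply/funext => i; apply/funext => j; rewrite /normalize rE x1 divr1.
Qed.

(** If all mixed differences vanished, [reduced_eq0] would make the matrix zero, against its entry
    sum 1. *)
Lemma realization_nondegenerate (x : {ptws {set G} -> R}) :
  realization R K x -> nondegenerate (coords x).
Proof.
move=> /realizationP[xred x1]; apply/not_existsP => mixed0.
have x0 i j : coords x i j = 0.
  apply: (@reduced_eq0 _ _ _ ord0 ord0 _ xred) => k l; apply: contrapT => /eqP N0.
  by apply: (mixed0 k); exists l.
move: x1; rewrite /entry_sum; under eq_bigr do under eq_bigr do rewrite x0.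
by rewrite big1 => [/eqP|i _]; rewrite ?big1 // eq_sym oner_eq0.
Qed.

Lemma continuous_to_complex (X : topologicalType) (A : X -> 'I_n -> 'I_n -> R) :
  (forall x, nondegenerate (A x)) ->
  (forall i j, continuous (fun x => A x i j)) ->
  continuous (fun x => to_complex (A x)).
Proof.
move=> nd cA; apply: continuous_to_ptws => e.
apply: continuous_sumr => p; apply: continuous_normalize => [i j|x].
  exact: continuous_reduce.
by rewrite gt_eqF // entry_sum_reduce_gt0.
Qed.

(** * Mixed differences as coordinates in dimension [d.+1] *)

Lemma card_minor_index : #|{: 'I_m.+1 * 'I_m.+1}| = d.+1.
Proof. by rewrite card_prod card_ord dim_eq expnS expn1. Qed.

(** Mixed differences based at (0, 0) vanish identically in row 0 and column 0, so only indices
    lifted past [ord0] are enumerated. *)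
Definition minor_index (k : 'I_d.+1) : 'I_n * 'I_n :=
  let p := enum_val (cast_ord (esym card_minor_index) k) in
  (lift ord0 p.1, lift ord0 p.2).

Lemma minor_index_inj : injective minor_index.
Proof.
move=> k l /eqP; rewrite xpair_eqE !(inj_eq lift_inj) => /andP[/eqP eq1 /eqP eq2].
apply: (@cast_ord_inj _ _ (esym card_minor_index)); apply: enum_val_inj.
by rewrite [LHS]surjective_pairing eq1 eq2 -surjective_pairing.
Qed.

Lemma minor_index_surj (i j : 'I_m.+1) :
  exists k, minor_index k = (lift ord0 i, lift ord0 j).
Proof.
exists (cast_ord card_minor_index (enum_rank (i, j))).
by rewrite /minor_index cast_ordK enum_rankK.
Qed.

Definition minor A (k : 'I_d.+1) : R :=
  mixed ord0 ord0 A (minor_index k).1 (minor_index k).2.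

Lemma nondegenerateP A : nondegenerate A <-> exists k, minor A k != 0.
Proof.
split=> [[i [j]]|[k Ak]]; last by exists (minor_index k).1, (minor_index k).2.
have [i' ->|->] := unliftP ord0 i; last first.
  by rewrite (_ : mixed ord0 ord0 A ord0 j = 0) ?eqxx // /mixed; ring.
have [j' ->|->] := unliftP ord0 j; last first.
  by rewrite (_ : mixed ord0 ord0 A _ ord0 = 0) ?eqxx // /mixed; ring.
by have [k kE] := minor_index_surj i' j'; exists k; rewrite /minor kE.
Qed.

Definition extend (z : 'rV[R]_d.+1) (i j : 'I_n) : R :=
  \sum_k z ord0 k *+ (minor_index k == (i, j)).

(** Row and column 0 of [extend z] are zero, so its mixed differences are its entries: [extend] is a
    linear section of [minor]. *)
Lemma minor_extend z k : minor (extend z) k = z ord0 k.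
Proof.
have border i j : (i == ord0) || (j == ord0) -> extend z i j = 0.
  move=> ij0; rewrite /extend big1 // => l _; rewrite xpair_eqE.
  by case/orP: ij0 => /eqP ->; rewrite /= ?andbF.
rewrite /minor /mixed !(border _ ord0) ?eqxx ?orbT // (border ord0) ?eqxx //.
rewrite !subr0 addr0 /extend -surjective_pairing (bigD1 k) //= eqxx mulr1n.
rewrite big1 ?addr0 // => l lk.
by rewrite (inj_eq minor_index_inj) (negbTE lk).
Qed.

(** * Rescaling to the unit sphere *)

Definition norm2 (v : 'I_d.+1 -> R) : R := Num.sqrt (\sum_k v k ^+ 2).

Lemma sum_sqr_gt0 (v : 'I_d.+1 -> R) :
  (exists k, v k != 0) -> 0 < \sum_k v k ^+ 2.
Proof.
case=> k vk; rewrite (bigD1 k) //= ltr_pwDl //; first by rewrite exprn_even_gt0.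
by rewrite sumr_ge0 // => l _; exact: sqr_ge0.
Qed.

Lemma norm2_gt0 (v : 'I_d.+1 -> R) : (exists k, v k != 0) -> 0 < norm2 v.
Proof. by move=> /sum_sqr_gt0; rewrite sqrtr_gt0. Qed.

Definition to_sphere A : 'rV[R]_d.+1 := \row_k (minor A k / norm2 (minor A)).

Lemma to_sphere_in A : nondegenerate A -> sphere R d (to_sphere A).
Proof.
move=> /nondegenerateP/sum_sqr_gt0 s0; rewrite /sphere /=.
under eq_bigr do rewrite mxE exprMn exprVn sqr_sqrtr ?(ltW s0) //.
by rewrite -mulr_suml divff // gt_eqF.
Qed.

Lemma continuous_to_sphere (X : topologicalType) (A : X -> 'I_n -> 'I_n -> R) :
  (forall x, nondegenerate (A x)) ->
  (forall i j, continuous (fun x => A x i j)) ->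
  continuous (fun x => to_sphere (A x)).
Proof.
move=> nd cA; apply: continuous_to_mx => i k.
under eq_fun do rewrite mxE.
have cminor l : continuous (fun x => minor (A x) l) by exact: continuous_mixed.
move=> x; apply: cvgM; first exact: cminor.
apply: cvgV; first by rewrite gt_eqF // norm2_gt0 //; exact/nondegenerateP.
apply: continuous_comp; last exact: sqrt_continuous.
by apply: continuous_sumr => l y; apply: cvgM; exact: cminor.
Qed.

Lemma sphere_nondegenerate (z : 'rV[R]_d.+1) :
  sphere R d z -> nondegenerate (extend z).
Proof.
rewrite /sphere /= => z1; apply/nondegenerateP/not_existsP => z0.
move: z1; rewrite big1 => [/eqP|k _]; first by rewrite eq_sym oner_eq0.
by have /negP := z0 k; rewrite negbK minor_extend => /eqP ->; rewrite expr0n.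
Qed.

(** Reduction preserves the minors and normalization divides them all by one positive number; as [z]
    has norm 1, rescaling undoes exactly this division. *)
Lemma to_sphereK (z : 'rV[R]_d.+1) :
  sphere R d z -> to_sphere (coords (to_complex (extend z))) = z.
Proof.
move=> z1; have s0 := entry_sum_reduce_gt0 (sphere_nondegenerate z1).
have minorE k : minor (coords (to_complex (extend z))) k =
    z ord0 k / entry_sum (reduce ord0 ord0 (extend z)).
  rewrite -minor_extend /minor -[in RHS](mixed_reduce ord0 ord0) -mixedZ.
  by congr mixed; do 2!apply/funext => ?; exact: of_coordsE.
have normE : norm2 (minor (coords (to_complex (extend z)))) =
    (entry_sum (reduce ord0 ord0 (extend z)))^-1.
  rewrite /norm2; under eq_bigr do rewrite minorE exprMn.
  by rewrite -mulr_suml z1 mul1r sqrtr_sqr ger0_norm // invr_ge0 ltW.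
apply/rowP => k; rewrite mxE minorE normE invrK divfK //.
by rewrite gt_eqF.
Qed.

(* Clamping makes the homotopy below defined and continuous for every real
   time, not only on [0, 1]. *)
Definition clamp (t : R) : R := Num.max 0 (Num.min 1 t).

Lemma clamp01 t : 0 <= clamp t <= 1.
Proof. by rewrite /clamp le_max lexx ge_max ler01 ge_min lexx. Qed.

Lemma continuous_clamp : continuous clamp.
Proof.
move=> t; apply: (@continuous_max R R (cst 0) (Num.min 1)); first exact: cvg_cst.
by apply: (@continuous_min R R (cst 1) id) => //; exact: cvg_cst.
Qed.

Definition interpolate (x : {ptws {set G} -> R}) (t : R) i j : R :=
  (1 - clamp t) * extend (to_sphere (coords x)) i j + clamp t * coords x i j.

(** Both ends of the segment have minors proportional to those of [x]. For [x] in the complex the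
    factor is positive, so the class of the segment stays on one open ray. *)
Lemma minor_interpolate x t k : minor (interpolate x t) k =
  ((1 - clamp t) / norm2 (minor (coords x)) + clamp t) * minor (coords x) k.
Proof.
transitivity ((1 - clamp t) * minor (extend (to_sphere (coords x))) k +
    clamp t * minor (coords x) k); first exact: mixed_lin.
by rewrite minor_extend mxE; ring.
Qed.

Lemma interpolate_nondegenerate x t :
  realization R K x -> nondegenerate (interpolate x t).
Proof.
move=> /realization_nondegenerate/nondegenerateP[k xk].
apply/nondegenerateP; exists k; rewrite minor_interpolate mulf_neq0 //.
have N0 : 0 < norm2 (minor (coords x)) by apply: norm2_gt0; exists k.
have /andP[c0 c1] := clamp01 t; rewrite gt_eqF //.
(* At [clamp t = 0] the first summand is positive; otherwise the second one is. *)
have [->|cN0] := eqVneq (clamp t) 0; first by rewrite subr0 addr0 divr_gt0.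
by rewrite ltr_wpDl ?lt_def ?cN0 // divr_ge0 ?subr_ge0 // ltW.
Qed.

(** * The maps and the homotopy between the actual spaces *)

Definition complex_to_sphere (x : set_type (realization R K)) :
    set_type (sphere R d) :=
  exist _ (to_sphere (coords (val x)))
    (mem_set (to_sphere_in (realization_nondegenerate (set_valP x)))).

Definition sphere_to_complex (z : set_type (sphere R d)) :
    set_type (realization R K) :=
  exist _ (to_complex (extend (val z)))
    (mem_set (to_complex_in (sphere_nondegenerate (set_valP z)))).

Definition deformation (xt : set_type (realization R K) * R) :
    set_type (realization R K) :=
  exist _ (to_complex (interpolate (val xt.1) xt.2))
    (mem_set (to_complex_in
      (interpolate_nondegenerate xt.2 (set_valP xt.1)))).

Lemma continuous_coords i j :
  continuous (fun x : set_type (realization R K) => coords (val x) i j).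
Proof.
move=> x; apply: (@continuous_comp _ _ _ set_val
  (fun y : {ptws {set G} -> R} => y (bip_edge (i, j)))).
  exact: initial_continuous.
exact: (@proj_continuous _ (fun=> R)).
Qed.

Lemma continuous_complex_to_sphere : continuous complex_to_sphere.
Proof.
apply: continuous_to_set_type; apply: continuous_to_sphere => [x|i j].
  exact: realization_nondegenerate (set_valP x).
exact: continuous_coords.
Qed.

Lemma continuous_extend (X : topologicalType) (z : X -> 'rV[R]_d.+1) i j :
  continuous z -> continuous (fun x => extend (z x) i j).
Proof.
move=> cz; apply: continuous_sumr => k x.
case: eqP => _; last exact: cvg_cst.
apply: (@continuous_comp _ _ _ z (fun y : 'rV[R]_d.+1 => y ord0 k)).
  exact: cz.
exact: coord_continuous.
Qed.

Lemma continuous_sphere_to_complex : continuous sphere_to_complex.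
Proof.
apply: continuous_to_set_type; apply: continuous_to_complex => [z|i j].
  exact: sphere_nondegenerate (set_valP z).
by apply: continuous_extend; exact: initial_continuous.
Qed.

Lemma continuous_deformation : continuous deformation.
Proof.
apply: continuous_to_set_type; apply: continuous_to_complex => [xt|i j].
  exact: interpolate_nondegenerate (set_valP xt.1).
pose X : topologicalType := (set_type (realization R K) * R)%type.
have cclamp : continuous (fun xt : X => clamp xt.2).
  by move=> xt; apply: continuous_comp; [exact: cvg_snd | exact: continuous_clamp].
have ccoords k l : continuous (fun xt : X => coords (val xt.1) k l).
  move=> xt; apply: (@continuous_comp X (set_type (realization R K)) R fst
    (fun x => coords (val x) k l)); first exact: cvg_fst.
  exact: continuous_coords.
have cextend : continuous (fun xt : X =>
    extend (to_sphere (coords (val xt.1))) i j).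
  apply: continuous_extend; apply: continuous_to_sphere => // xt.
  exact: realization_nondegenerate (set_valP xt.1).
move=> xt; apply: cvgD; apply: cvgM; [|exact: cextend|exact: cclamp|exact: ccoords].
by apply: cvgB; [exact: cvg_cst | exact: cclamp].
Qed.

Lemma matching_complex_sphere : homotopy_equivalent R
  (set_type (realization R K)) (set_type (sphere R d)).
Proof.
exists complex_to_sphere, sphere_to_complex; split.
- exact: continuous_complex_to_sphere.
- exact: continuous_sphere_to_complex.
- exists deformation; split=> [|x|x].
  + exact/continuous_subspaceT/continuous_deformation.
  (* At time 0 the segment is at the representative [extend (to_sphere (coords x))]. *)
  + apply: val_inj; congr to_complex; do 2!apply/funext => ?.
    rewrite /interpolate /clamp (min_idPr ler01) maxxx subr0.
    by rewrite mul1r mul0r addr0.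
  (* At time 1 it is at [coords x], already reduced of sum 1, hence fixed by [to_complex]. *)
  + apply: val_inj => /=; rewrite -[RHS](to_complex_id (set_valP x)).
    congr to_complex; do 2!apply/funext => ?.
    rewrite /interpolate /clamp minxx (max_idPr ler01) subrr.
    by rewrite mul0r mul1r add0r.
- have -> : complex_to_sphere \o sphere_to_complex = idfun.
    by apply/funext => z; apply: val_inj; exact: to_sphereK (set_valP z).
  (* The composite is exactly the identity, so the constant homotopy suffices. *)
  exists fst; split=> // ; apply: continuous_subspaceT => xt; exact: cvg_fst.
Qed.

End Equivalence.

Theorem theorem1p2 (R : realType) (n : nat) (hn : (2 <= n)%N) :
  homotopy_equivalent R
    (set_type (realization R (matching_complex (n - 1) (complete_bipartite n n))))
    (set_type (sphere R ((n - 1) ^ 2 - 1)%N)).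
Proof.
case: n hn => [|[|m]] // _; rewrite [(m.+2 - 1)%N]subn1.
apply: matching_complex_sphere.
(* The square is positive, so the truncated subtraction of 1 is undone by the successor. *)
by rewrite subn1 prednK // expn_gt0.
Qed.
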